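(* Let $(X,g)$ be a compact minimal system, and let $\mathcal{CO}^*(X)$ be the set of nonempty clopen subsets of $X$. Then for all $A,B\in\mathcal{CO}^*(X)$ we have \[ g_Ag_B=g_{A\ast B}\,g_{A\cup B}, \] where $A\ast B$ is the following nonempty clopen subset of $A\cup B$: \[ A\ast B:=(A\cap g_{A\cup B}(B))\cup((B\smallsetminus A)\cap g_{A\cup B}(A\smallsetminus B)). \] With respect to the generating set $\{g_A\mid A\in\mathcal{CO}^*(X)\}$, $\tau_{\mathbb{N}}[g]$ has the monoid presentation \[ \tau_{\mathbb{N}}[g]=\langle\{g_A\mid A\in\mathcal{CO}^*(X)\}\mid g_Ag_B=g_{A\ast B}\,g_{A\cup B}\ (A,B\in\mathcal{CO}^*(X))\rangle. \]
   Context: A homeomorphism $g$ of a Hausdorff space $X$ is minimal if $X\neq\emptyset$ and the only proper closed subset $K\subsetneq X$ with $gK\subseteq K$ is $K=\emptyset$. A compact minimal system $(X,g)$ is an infinite compact Hausdorff space $X$ with a minimal homeomorphism $g$ of $X$ (so $g$ is aperiodic). The topological full group $\tau[g]$ is the group of all homeomorphisms $h$ of $X$ for which there is a locally constant function $c:X\to\mathbb{Z}$ (unique, since $g$ is aperiodic) with $hx=g^{c(x)}x$ for all $x\in X$. An element $h\in\tau[g]$ is strongly positive if for every $y\in X$ with $hy\ne y$ we have $c(y)>0$; $\tau_{\mathbb{N}}[g]$ is the set of strongly positive elements of $\tau[g]$, a submonoid of $\tau[g]$. For a nonempty clopen $A\subseteq X$, the induced transformation $g_A$ is the homeomorphism of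 $X$ with $g_Ax=g^tx$ for $x\in A$, where $t$ is the least positive integer such that $g^tx\in A$, and $g_Ax=x$ for $x\in X\smallsetminus A$. Products are compositions of maps, applied right to left. *)

(* Defs.v *)
From HB Require Import structures.
From mathcomp Require Import all_boot all_order all_algebra.
From mathcomp Require Import all_classical topology.

Set Implicit Arguments.
Unset Strict Implicit.
Unset Printing Implicit Defensive.

Import Order.TTheory GRing.Theory Num.Theory.
Local Open Scope classical_set_scope.
Local Open Scope ring_scope.

(* The congruence on the free monoid [seq I] (with [++] as product) generated
   by a relation [R]. *)
Inductive gen_congruence (I : Type) (R : seq I -> seq I -> Prop) :
    seq I -> seq I -> Prop :=
| gen_congruence_base u v : R u v -> gen_congruence R u v
| gen_congruence_refl u : gen_congruence R u u
| gen_congruence_sym u v : gen_congruence R u v -> gen_congruence R v u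
| gen_congruence_trans u v w :
    gen_congruence R u v -> gen_congruence R v w -> gen_congruence R u w
| gen_congruence_cat u v u' v' :
    gen_congruence R u v -> gen_congruence R u' v' ->
    gen_congruence R (u ++ u') (v ++ v').

Definition word_eval (T : monoidType) (S : set T) (w : seq S) : T :=
  \big[*%g/1%g]_(s <- w) \val s.

(* [M] has the presentation < S | R > with respect to the subset [S]: the
   evaluation morphism from the free monoid over [S] has image [M], and two words
   have the same value exactly when they are congruent modulo [R]. The first
   clause makes [M] a submonoid of [T]. *)
Definition has_monoid_presentation (T : monoidType) (M S : set T)
    (R : seq S -> seq S -> Prop) : Prop :=
  range (@word_eval T S) = M /\
  (forall u v : seq S, word_eval u = word_eval v <-> gen_congruence R u v).

(* The product of self-maps is composition, [f * h = f \o h]. *)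
Definition selfmap (X : Type) : Type := X -> X.

HB.instance Definition _ (X : Type) := gen_eqMixin (selfmap X).
HB.instance Definition _ (X : Type) := gen_choiceMixin (selfmap X).
HB.instance Definition _ (X : Type) := @isMonoid.Build (selfmap X)
  (fun f h => f \o h) id
  (fun f h k => erefl) (fun f => erefl) (fun f => erefl).

Section TopologicalFullGroup.
Variable X : topologicalType.
Implicit Types (g h : X -> X) (c : X -> int) (A B K : set X) (x y : X).

Definition homeomorphism h : Prop :=
  exists k : X -> X,
    [/\ cancel h k, cancel k h, continuous h & continuous k].

Definition minimal_homeomorphism g : Prop :=
  [/\ homeomorphism g, [set: X] !=set0
    & forall K, closed K -> K `<` [set: X] -> g @` K `<=` K -> K = set0].

Definition compact_minimal_system g : Prop :=
  [/\ infinite_set [set: X], compact [set: X], hausdorff_space X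
    & minimal_homeomorphism g].

(* Only meaningful for bijective [g]. *)
Definition inverse_map g : X -> X := fun y => xget y [set x | g x = y].

Definition iterz g (n : int) : X -> X :=
  match n with
  | Posz m => iter m g
  | Negz m => iter m.+1 (inverse_map g)
  end.

Definition locally_constant c : Prop := forall x, \forall y \near x, c y = c x.

(* Such a [c] is unique when [g] is aperiodic. *)
Definition cocycle g h c : Prop :=
  locally_constant c /\ (forall x, h x = iterz g (c x) x).

Definition topological_full_group g : set (selfmap X) :=
  [set h | homeomorphism h /\ (exists c, cocycle g h c)].

Definition strongly_positive g h : Prop :=
  exists2 c, cocycle g h c & forall y, h y <> y -> 0 < c y.

Definition positive_monoid g : set (selfmap X) :=
  [set h | topological_full_group g h /\ strongly_positive g h].

Definition clopen_star : set (set X) := [set A | clopen A /\ A !=set0].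

Definition is_return_time g A x (t : nat) : Prop :=
  [/\ (0 < t)%N, A (iter t g x)
    & forall s, (0 < s)%N -> A (iter s g x) -> (t <= s)%N].

(* The default [0%N] is irrelevant for a minimal [g] on a compact space and a
   nonempty clopen [A], since then every point returns to [A]. *)
Definition return_time g A x : nat := xget 0%N (is_return_time g A x).

Definition induced g A : X -> X :=
  fun x => if x \in A then iter (return_time g A x) g x else x.

Definition clopen_ast g A B : set X :=
  (A `&` induced g (A `|` B) @` B) `|`
  ((B `\` A) `&` induced g (A `|` B) @` (A `\` B)).

Definition induced_generators g : set (selfmap X) :=
  [set (induced g A : selfmap X) | A in clopen_star].

(* The relations g_A g_B = g_{A*B} g_{A u B}, as pairs of words of length 2. *)
Definition induced_relations g (u v : seq (induced_generators g)) : Prop :=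
  exists A B, [/\ clopen_star A, clopen_star B,
    map \val u = [:: (induced g A : selfmap X); induced g B]
  & map \val v = [:: (induced g (clopen_ast g A B) : selfmap X);
                     induced g (A `|` B)]].

End TopologicalFullGroup.

(* Main.v *)
(* For U = A `|` B write f = g_U. First returns to A or B under g are first
   returns under f, and a point f w lies in A * B exactly when w is in B and
   f w is in A, or w is in A \ B and f w is in B \ A. Following an f-orbit
   through the blocks where it stays in A \ B or in B \ A then gives
   g_A g_B = g_(A*B) g_U.

   Reading the relation from left to right moves the larger set to the right,
   so that every word is congruent to one g_(A_1) ... g_(A_n) with
   A_1 `<=` ... `<=` A_n. The value h of such a word determines it: A_n is the
   support of h, and g_(A_n) can be cancelled. Conversely, if h is strongly
   positive with support S, then h moves S into itself, so its cocycle is at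
   least the return time to S, and h g_S^-1 is strongly positive with a
   cocycle whose maximum is smaller; by compactness the descent ends. *)
Require Import Defs.
From HB Require Import structures.
From mathcomp Require Import all_boot all_order all_algebra.
From mathcomp Require Import all_classical topology.
From mathcomp Require Import zify.

Set Implicit Arguments.
Unset Strict Implicit.
Unset Printing Implicit Defensive.

Local Open Scope classical_set_scope.

(** The first visit to [A] after [x] along the [f]-orbit. The inductive form allows induction along
    the orbit with no return time to carry. *)
Inductive next_in (X : Type) (f : X -> X) (A : set X) (x : X) : X -> Prop :=
| next_in_now : A (f x) -> next_in f A x (f x)
| next_in_later y : ~ A (f x) -> next_in f A (f x) y -> next_in f A x y.

Lemma next_in_mem (X : Type) (f : X -> X) (A : set X) x y :
  next_in f A x y -> A y.
Proof. by elim. Qed.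

Lemma next_in_inj (X : Type) (f : X -> X) (A : set X) x y z :
  next_in f A x y -> next_in f A x z -> y = z.
Proof.
move=> xy; elim: xy z => {x y} [x Afx|x y nAfx _ IH] z xz.
  by case: xz => [//|w []].
by case: xz => [/nAfx[]|w _ /IH].
Qed.

(** * First returns and induced transformations *)

Section Induced.
Variables (X : topologicalType) (g : X -> X).
Implicit Types (A B U : set X) (x y z : X).

Lemma return_next_in A x t :
  is_return_time g A x t -> next_in g A x (iter t g x).
Proof.
elim: t x => [|t IH] x [// _ At tmin].
have [Agx|nAgx] := pselect (A (g x)).
  suff -> : t = 0%N by apply: next_in_now.
  by have := tmin 1%N isT Agx; case: (t).
have t0 : (0 < t)%N by case: t At {IH tmin}.
apply: next_in_later => //; rewrite iterSr; apply: IH; split=> //.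
  by rewrite -iterSr.
by move=> s s0; rewrite -iterSr => /tmin; apply.
Qed.

(** Asked of every [x], not only of points of [A]; it ensures that [return_time] never takes its
    default value. *)
Definition recurrent A := forall x, exists2 t, (0 < t)%N & A (iter t g x).

Lemma return_timeP A x : recurrent A -> is_return_time g A x (return_time g A x).
Proof.
move=> /(_ x)[t t0 At]; rewrite /return_time.
case: xgetP => [s -> //|/(_ _)/[dup] nr _].
have ex : exists s, (0 < s)%N && `[< A (iter s g x) >].
  by exists t; rewrite t0; apply/asboolP.
case: (ex_minnP ex) => m /andP[m0 /asboolP Am] mmin.
case: (nr m); split=> // s s0 As; apply: mmin; rewrite s0; exact/asboolP.
Qed.

Lemma induced_in A x : recurrent A -> A x -> next_in g A x (induced g A x).
Proof.
move=> rA Ax; rewrite /induced mem_set//.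
exact/return_next_in/return_timeP.
Qed.

Lemma induced_out A x : ~ A x -> induced g A x = x.
Proof. by move=> nAx; rewrite /induced memNset. Qed.

Lemma induced_next_in A x y :
  recurrent A -> A x -> next_in g A x y -> induced g A x = y.
Proof. by move=> rA Ax; apply: next_in_inj; apply: induced_in. Qed.

Lemma induced_mem A x : recurrent A -> A x -> A (induced g A x).
Proof. by move=> rA Ax; exact: next_in_mem (induced_in rA Ax). Qed.

(** The exponent of [induced g A], zero off [A], so that one formula covers all points. *)
Definition induced_time A x := if x \in A then return_time g A x else 0%N.

Lemma induced_iter A x : induced g A x = iter (induced_time A x) g x.
Proof. by rewrite /induced /induced_time; case: ifP. Qed.

Lemma induced_time_gt0 A x : recurrent A -> A x -> (0 < induced_time A x)%N.
Proof.
by move=> rA Ax; rewrite /induced_time mem_set//; case: (return_timeP x rA).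
Qed.

(** Passing from [g] to [induced g U] only skips points outside [U], and these lie outside [A]. *)
Lemma next_in_induced A U x z : recurrent U -> A `<=` U ->
  U x -> next_in g A x z -> next_in (induced g U) A x z.
Proof.
move=> rU AU Ux xz; have xU := induced_in rU Ux.
(* Here [w] runs along the [g]-orbit while [x0] stays at the last point of [U] passed: the next
   visit to [U] after [w] is [induced g U x0]. *)
have {Ux} key : forall w, next_in g A w z ->
    forall x0, (forall u, next_in g U w u -> induced g U x0 = u) ->
    next_in (induced g U) A x0 z.
  move=> w; elim=> {w z xz} [w Agw|w z nAgw _ IH] x0 x0E.
    have <- := x0E _ (next_in_now (AU _ Agw)).
    by apply: next_in_now; rewrite (x0E _ (next_in_now (AU _ Agw))).
  have [Ugw|nUgw] := pselect (U (g w)).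
    have gwE := x0E _ (next_in_now Ugw).
    apply: next_in_later; rewrite gwE//; apply: IH => u.
    exact: induced_next_in.
  by apply: IH => u gwu; apply: x0E; apply: next_in_later.
by apply: key xz _ _ => u; apply: next_in_inj.
Qed.

Hypothesis g_inj : injective g.

Lemma iter_inj n : injective (iter n g).
Proof. by elim: n => // n IH x y /g_inj/IH. Qed.

(** For first returns g^s x = g^t y of points of [A] with s < t, the point x = g^(t-s) y would be a
    visit of [y] to [A] at a positive time below t. *)
Lemma induced_inj A : recurrent A -> injective (induced g A).
Proof.
move=> rA x y; have [Ax|nAx] := pselect (A x); last first.
  rewrite (induced_out nAx); have [Ay|nAy] := pselect (A y).
    by move=> xE; case: nAx; rewrite xE; exact: induced_mem.
  by rewrite induced_out.
have [Ay|nAy] := pselect (A y); last first.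
  by rewrite (induced_out nAy) => yE; case: nAy; rewrite -yE; exact: induced_mem.
rewrite /induced !mem_set//.
wlog : x y Ax Ay / (return_time g A x <= return_time g A y)%N.
  move=> W; case: (leqP (return_time g A x) (return_time g A y)); first exact: W.
  by move=> /ltnW /W /[swap] /esym e h; rewrite h.
case: (return_timeP x rA) (return_timeP y rA) => + _ _ [_ _ +].
move: (return_time g A x) (return_time g A y) => s t s0 tmin st.
rewrite -(subnKC st) iterD => /iter_inj xE.
move: st tmin xE; rewrite leq_eqVlt => /predU1P[<- _|st tmin xE].
  by rewrite subnn.
have := tmin (t - s)%N; rewrite -xE subn_gt0 => /(_ st Ax).
by lia.
Qed.

Lemma clopen_ast_sub A B : clopen_ast g A B `<=` A `|` B.
Proof. by move=> x [[Ax _]|[[Bx _] _]]; [left|right]. Qed.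

(** * The product of two induced transformations *)

Section Relation.
Variables A B : set X.
Hypotheses (rA : recurrent A) (rB : recurrent B).
Let U := A `|` B.
Let f := induced g U.
Let C := clopen_ast g A B.

Let rU : recurrent U.
Proof. by move=> x; have [t t0 At] := rA x; exists t => //; left. Qed.

Let fU x : U x -> U (f x).
Proof. exact: (induced_mem rU). Qed.

Let f_inj : injective f.
Proof. exact: (induced_inj rU). Qed.

(** Injectivity of [f] turns the images in the definition of [C] into conditions on the predecessor
    [w]. *)
Lemma clopen_astP w :
  C (f w) <-> (A (f w) /\ B w) \/ (~ A (f w) /\ B (f w) /\ A w /\ ~ B w).
Proof.
split=> [[[Af [v Bv /f_inj vw]]|[[Bf nAf] [v [Av nBv] /f_inj vw]]]|].
- by left; split=> //; rewrite -vw.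
- by right; rewrite -vw in Bf nAf *.
- case=> [[Af Bw]|[nAf [Bf [Aw nBw]]]]; first by left; split=> //; exists w.
  by right; split=> //; exists w.
Qed.

(** After a point of [B] the orbit stays in B \ A until it meets [A]. That block avoids [C], and the
    first point of [A] is in [C] because its predecessor is in [B]. *)
Lemma next_in_astB w z : B w -> next_in f A w z -> next_in f C w z.
Proof.
move=> Bw wz; elim: wz Bw => {w z} [w Af|w z nAf _ IH] Bw.
  by apply: next_in_now; apply/clopen_astP; left.
apply: next_in_later; first by move=> /clopen_astP[[]|[_ [_ []]]].
by apply: IH; case: (fU (or_intror Bw)).
Qed.

(** After [w] the orbit stays in A \ B, off [C], up to its first point [z] of [B]. The branches
    match the action of g_A on [z]: a point of [A] moves on to its next return, any other is fixed
    and already lies in [C]. *)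
Lemma next_in_astA w z : A w -> ~ B w -> next_in f B w z ->
  if pselect (A z) then forall z', next_in f A z z' -> next_in f C w z'
  else next_in f C w z.
Proof.
move=> Aw nBw wz; elim: wz Aw nBw => {w z} [w Bf|w z nBf _ IH] Aw nBw.
  case: pselect => [Af z' zz'|nAf].
    apply: next_in_later; last exact: next_in_astB.
    by move=> /clopen_astP[[]|[]].
  by apply: next_in_now; apply/clopen_astP; right.
have Af : A (f w) by case: (fU (or_introl Aw)).
have nC : ~ C (f w) by move=> /clopen_astP[[]|[]].
move: (IH Af nBf); case: pselect => [Az h z' /h|nAz h]; exact: next_in_later.
Qed.

(** By [next_in_astB], the first visit to [A] after a point of [B] lies in [C]. *)
Lemma clopen_ast_nonempty : (exists x, B x) -> exists x, C x.
Proof.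
move=> [x Bx]; have Ux : U x by right.
have [y xy] : exists y, next_in g A x y.
  by eexists; apply: return_next_in; exact: return_timeP.
exists y; apply: next_in_mem (next_in_astB Bx _).
by apply: next_in_induced xy => // ? ?; left.
Qed.

Lemma induced_ast_comp : recurrent C ->
  induced g A \o induced g B = induced g C \o f.
Proof.
move=> rC; apply/funext => x /=.
have AU : A `<=` U by left.
have BU : B `<=` U by right.
have CU : C `<=` U := @clopen_ast_sub A B.
have [Ux|nUx] := pselect (U x); last first.
  have nA : ~ A x by move=> /AU.
  have nB : ~ B x by move=> /BU.
  have nC : ~ C x by move=> /CU.
  by rewrite /f !induced_out // induced_out.
(* As [A], [B] and [C] lie in [U], all three induced maps can be read off the orbits of [f]. *)
have inA y : A y -> next_in f A y (induced g A y).
  by move=> Ay; apply: next_in_induced => //; [exact: AU|exact: induced_in].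
have inB y : B y -> next_in f B y (induced g B y).
  by move=> By; apply: next_in_induced => //; [exact: BU|exact: induced_in].
have inC y z : C y -> next_in f C y z -> induced g C y = z.
  move=> Cy; apply: next_in_inj.
  by apply: next_in_induced => //; [exact: CU|exact: induced_in].
(* For [x] in [B], the point [f x] is in [C] exactly when it is in [A]. *)
have [Bx|nBx] := pselect (B x).
  have := inB _ Bx; move: (induced g B x) => z xz.
  case: xz => [Bf|{}z nBf fz].
    have [Af|nAf] := pselect (A (f x)).
      apply/esym/inC; first by apply/clopen_astP; left.
      by apply: next_in_astB => //; exact: inA.
    by rewrite !induced_out //; move=> /clopen_astP[[]|[_ [_ []]]].
  have Af : A (f x) by case: (fU Ux).
  have Cf : C (f x) by apply/clopen_astP; left.
  apply/esym/inC => //; have := next_in_astA Af nBf fz.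
  case: pselect => [Az|nAz]; first by apply; exact: inA.
  by rewrite induced_out.
(* Now [x] is in A \ B, so [f x] is in [C] exactly when it is in B \ A. *)
have Ax : A x by case: Ux.
rewrite (induced_out nBx).
have := inA _ Ax; move: (induced g A x) => z xz.
case: xz => [Af|{}z nAf fz].
  by rewrite induced_out //; move=> /clopen_astP[[]|[]].
have Bf : B (f x) by case: (fU Ux).
apply/esym/inC; first by apply/clopen_astP; right.
exact: next_in_astB.
Qed.

End Relation.
End Induced.

(** * Locally constant exponents and homeomorphisms of compact spaces *)

Section LocallyConstant.
Variable X : topologicalType.
Implicit Types (A : set X) (n : X -> nat).

Definition nat_locally_constant n := forall x, \forall y \near x, n y = n x.

Lemma nat_locally_constant_clopen n (P : set nat) :
  nat_locally_constant n -> clopen [set x | P (n x)].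
Proof.
move=> lc; suff op (Q : set nat) : open [set x | Q (n x)].
  by split=> //; rewrite -openC; exact: (op (~` P)).
rewrite openE => x Qx; rewrite /interior /=.
by apply: filterS (lc x) => y /= ->.
Qed.

(** Near each point every large [i] is a bound; compactness, as a near-covering property for the
    filter [\oo], makes the bound uniform. *)
Lemma nat_locally_constant_bounded n :
  compact [set: X] -> nat_locally_constant n ->
  exists N, forall x, (n x <= N)%N.
Proof.
move=> /compact_near_coveringP/(_ nat \oo (fun i x => n x <= i)%N) cX lc.
have [x _|N _ /(_ _ (leqnn N)) h] := cX _.
  exists ([set y | n y = n x], [set i | n x <= i]%N) => /=.
    by split; [exact: lc|exists (n x)].
  by move=> [y i] /= [->].
by exists N => x; exact: h.
Qed.

Lemma clopen_near A x : clopen A -> \forall y \near x, A y <-> A x.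
Proof.
move=> [oA cA]; have [Ax|nAx] := pselect (A x).
  have : nbhs x A by exact: open_nbhs_nbhs.
  by apply: filterS => y.
have : nbhs x (~` A) by apply: open_nbhs_nbhs; split=> //; exact: closed_openC.
by apply: filterS => y nAy; split.
Qed.

(** The inverse is continuous because images of closed sets are compact, hence closed in a Hausdorff
    space. *)
Lemma compact_bijective_homeomorphism (f : X -> X) :
  compact [set: X] -> hausdorff_space X -> continuous f -> injective f ->
  (forall y, exists x, f x = y) -> homeomorphism f.
Proof.
move=> cX hX cf f_inj /choice[k fk]; exists k; split=> //.
  by move=> x; apply: f_inj; rewrite fk.
apply/continuous_closedP => C cC.
have -> : k @^-1` C = f @` C.
  apply/seteqP; split=> [y Cy|_ [x Cx <-]]; first by exists (k y).
  by rewrite /preimage /= (f_inj _ _ (fk (f x))).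
apply: compact_closed => //; apply: continuous_compact.
  exact: continuous_subspaceT.
exact: subclosed_compact cX _.
Qed.

Lemma homeomorphism_comp (f h : X -> X) :
  homeomorphism f -> homeomorphism h -> homeomorphism (f \o h).
Proof.
move=> [f' [fK fK' cf cf']] [h' [hK hK' ch ch']].
exists (h' \o f'); split; [exact: can_comp|exact: can_comp| |].
  by move=> x; apply: continuous_comp; [exact: ch|exact: cf].
by move=> x; apply: continuous_comp; [exact: cf'|exact: ch'].
Qed.

Lemma homeomorphism_inj (f : X -> X) : homeomorphism f -> injective f.
Proof. by case=> k [fK _ _ _]; exact: can_inj fK. Qed.

Lemma homeomorphism_continuous (f : X -> X) : homeomorphism f -> continuous f.
Proof. by case=> k []. Qed.

Lemma iter_continuous (f : X -> X) m : continuous f -> continuous (iter m f).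
Proof.
move=> cf; elim: m => [|m IH] x; first exact: cvg_id.
by apply: (@continuous_comp _ _ _ (iter m f) f); [exact: IH|exact: cf].
Qed.

End LocallyConstant.

(** * Induced transformations and strongly positive maps of a minimal system *)

Section MinimalSystem.
Variables (X : topologicalType) (g : X -> X).
Hypothesis gmin : compact_minimal_system g.
Implicit Types (A : set X) (x y : X) (h : X -> X) (n : X -> nat).

Let cX : compact [set: X]. Proof. by case: gmin. Qed.
Let hX : hausdorff_space X. Proof. by case: gmin. Qed.
Let g_homeo : homeomorphism g. Proof. by case: gmin => _ _ _ []. Qed.

Lemma minimal_inj : injective g.
Proof. exact: homeomorphism_inj. Qed.

Lemma minimal_iter_continuous m : continuous (iter m g).
Proof. exact/iter_continuous/homeomorphism_continuous. Qed.

Lemma minimal_closed_invariant (K : set X) : closed K ->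
  (forall x, K x -> K (g x)) -> K = setT \/ K = set0.
Proof.
move=> cK gK; have [KT|KT] := pselect (K = setT); first by left.
right; have [_ _ _ [_ _ mK]] := gmin; apply: mK => //.
  by rewrite properEneq; split=> //; exact/eqP.
by move=> _ [x Kx <-]; exact: gK.
Qed.

(** The points whose forward orbit avoids [A] form a closed invariant set missing [a], so there are
    none. Applying this to [g x] yields a positive time. *)
Lemma minimal_recurrent A : clopen_star A -> recurrent g A.
Proof.
move=> [cA [a Aa]] x.
pose K := \bigcap_(t in [set: nat]) (iter t g @^-1` (~` A)).
have cK : closed K.
  apply: closed_bigI => t _; apply: (proj1 (continuous_closedP _)).
    exact: minimal_iter_continuous.
  by apply: open_closedC; case: cA.
have gK y : K y -> K (g y) by move=> Ky t _; rewrite /preimage/= -iterSr; exact: Ky.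
have [KT|K0] := minimal_closed_invariant cK gK.
  by have : K a; [rewrite KT|move=> /(_ 0%N I)].
apply: contrapT => nA.
suff : K (g x) by rewrite K0.
move=> t _; rewrite /preimage /= -iterSr => At; apply: nA.
by exists t.+1.
Qed.

(** A periodic orbit would be a finite, hence closed, nonempty invariant set, so all of the infinite
    space. *)
Lemma minimal_aperiodic m x : (0 < m)%N -> iter m g x <> x.
Proof.
move=> m0 mx; pose K := [set iter i g x | i in `I_m].
have finK : finite_set K by apply: finite_image; exact: finite_II.
have cK : closed K.
  exact: (proj1 accessible_finite_set_closed (hausdorff_accessible hX)).
have gK y : K y -> K (g y).
  move=> [i /= im <-]; have [im1|] := ltnP i.+1 m; first by exists i.+1.
  by move=> mi; exists 0%N => //=; rewrite -iterS (_ : i.+1 = m) ?mx //; lia.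
have Kx : K x by exists 0%N.
have [KT|K0] := minimal_closed_invariant cK gK; last by rewrite K0 in Kx.
by case: gmin => inf _ _ _; apply: inf; rewrite -KT.
Qed.

Lemma return_time_locally_constant A :
  clopen_star A -> nat_locally_constant (return_time g A).
Proof.
move=> cA x; have rA := minimal_recurrent cA.
have hits m : \forall y \near x, forall s, (s <= m)%N ->
    (A (iter s g y) <-> A (iter s g x)).
  elim: m => [|m IH].
    have := @clopen_near _ A x (proj1 cA).
    by apply: filterS => y yx s; rewrite leqn0 => /eqP ->.
  have := @clopen_near _ (iter m.+1 g @^-1` A) x
    (preimage_clopen (proj1 cA) (@minimal_iter_continuous m.+1)).
  apply: filterS2 IH => y ym yx s; rewrite leq_eqVlt => /predU1P[->//|].
  exact: ym.
apply: filterS (hits (return_time g A x)) => y yx.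
have [x0 Ax xmin] := return_timeP x rA.
have [y0 Ay ymin] := return_timeP y rA.
(* This bound comes first, since [yx] compares visits only up to the return time of [x]. *)
have yx_le : (return_time g A y <= return_time g A x)%N.
  by apply: ymin => //; apply/yx.
by apply/eqP; rewrite eqn_leq yx_le xmin //; apply/yx.
Qed.

Lemma induced_time_locally_constant A :
  clopen_star A -> nat_locally_constant (induced_time g A).
Proof.
move=> cA x.
have := @clopen_near _ A x (proj1 cA).
apply: filterS2 (return_time_locally_constant cA x) => y yx Ayx.
rewrite /induced_time yx.
by case: ifPn; case: ifPn => //; rewrite !(in_setE, notin_setE) => ? ?; tauto.
Qed.

Lemma locally_constant_iter_continuous h n :
  nat_locally_constant n -> (forall x, h x = iter (n x) g x) -> continuous h.
Proof.
move=> lc hE x.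
have : {for x, continuous (iter (n x) g)} by exact: minimal_iter_continuous.
rewrite /prop_for /continuous_at -hE; apply: cvg_trans.
by apply: near_eq_cvg; apply: filterS (lc x) => y yx; rewrite hE yx.
Qed.

(** A point [y] of [A] is the first return of the last point of [A] strictly before it; bounded
    return times provide such a point. *)
Lemma induced_surj A : clopen_star A -> forall y, exists x, induced g A x = y.
Proof.
move=> cA y; have rA := minimal_recurrent cA.
have [Ay|nAy] := pselect (A y); last by exists y; rewrite induced_out.
have [N leN] := nat_locally_constant_bounded cX (return_time_locally_constant cA).
have [k [gK gK' _ _]] := g_homeo.
have iterK t z : iter t g (iter t k z) = z.
  by elim: t z => // t IH z; rewrite iterS (iterSr t k) IH gK'.
(* Going [N.+1] steps back exceeds every return time, so the orbit of [z] visits [A] strictly before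
   reaching [y]. *)
pose z := iter N.+1 k y.
have [z0 Az _] := return_timeP z rA.
have ex : exists s, (0 < s)%N && `[< exists2 x, A x & iter s g x = y >].
  exists (N.+1 - return_time g A z)%N; rewrite subn_gt0 ltnS leN.
  apply/asboolP; exists (iter (return_time g A z) g z) => //.
  by rewrite -iterD subnK ?iterK // ltnW // ltnS leN.
case: (ex_minnP ex) => s /andP[s0 /asboolP[x Ax xy]] smin.
exists x; apply: induced_next_in => //; rewrite -xy.
apply: return_next_in; split=> //; first by rewrite xy.
move=> r r0 Ar; rewrite leqNgt; apply/negP => rs.
have := smin (s - r)%N; rewrite subn_gt0 rs /= => h.
have : (s <= s - r)%N.
  by apply: h; apply/asboolP; exists (iter r g x) => //; rewrite -iterD subnK // ltnW.
by lia.
Qed.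

Lemma induced_homeomorphism A : clopen_star A -> homeomorphism (induced g A).
Proof.
move=> cA; apply: compact_bijective_homeomorphism => //.
- apply: (@locally_constant_iter_continuous _ (induced_time g A)).
    exact: induced_time_locally_constant.
  exact: induced_iter.
- by apply: induced_inj; [exact: minimal_inj|exact: minimal_recurrent].
- exact: induced_surj.
Qed.

Lemma clopen_star_setU A B :
  clopen_star A -> clopen_star B -> clopen_star (A `|` B).
Proof.
move=> [cA [a Aa]] [cB _]; split; first exact: clopenU.
by exists a; left.
Qed.

(** Images under the induced homeomorphism of the union are preimages under its continuous inverse,
    hence clopen. *)
Lemma clopen_star_ast A B :
  clopen_star A -> clopen_star B -> clopen_star (clopen_ast g A B).
Proof.
move=> cA cB; have cU := clopen_star_setU cA cB.
have [k [fK fK' _ ck]] := induced_homeomorphism cU.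
have imE D : induced g (A `|` B) @` D = k @^-1` D.
  apply/seteqP; split=> [_ [x Dx <-]|y Dy]; first by rewrite /preimage /= fK.
  by exists (k y).
have cD : clopen (A `&` ~` B) by apply: clopenI; [case: cA|apply: clopenC; case: cB].
have cE : clopen (B `&` ~` A) by apply: clopenI; [case: cB|apply: clopenC; case: cA].
split; last first.
  apply: clopen_ast_nonempty.
  - exact: minimal_inj.
  - exact: minimal_recurrent.
  - by case: cB.
rewrite /clopen_ast !imE !setDE; apply: clopenU; apply: clopenI => //.
- by case: cA.
- by apply: preimage_clopen => //; case: cB.
- exact: preimage_clopen.
Qed.

Lemma induced_comp A B : clopen_star A -> clopen_star B ->
  induced g A \o induced g B =
  induced g (clopen_ast g A B) \o induced g (A `|` B).
Proof.
move=> cA cB; apply: induced_ast_comp; first exact: minimal_inj.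
all: apply: minimal_recurrent => //; exact: clopen_star_ast.
Qed.

(** Natural exponents suffice: where the integer cocycle is not positive, [h] fixes the point and
    exponent zero serves. *)
Lemma positive_monoidP h : positive_monoid g h <->
  homeomorphism h /\ exists n, nat_locally_constant n /\
    (forall x, h x = iter (n x) g x).
Proof.
split=> [[[hh _] [c [lc hE] cpos]]|[hh [n [lc hE]]]].
  split=> //; exists (fun x => if (0 < c x)%R then `|c x|%N else 0%N).
  split=> x; first by apply: filterS (lc x) => y ->.
  case: ifPn => [|/negP nc]; first by rewrite hE; case: (c x).
  by apply: contrapT => /cpos.
have coc : cocycle g h (fun x => Posz (n x)).
  by split=> // x; apply: filterS (lc x) => y ->.
split; first by split=> //; exists (fun x => Posz (n x)).
exists (fun x => Posz (n x)) => // x; rewrite hE.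
by case: (n x).
Qed.

Lemma positive_monoid_id : positive_monoid g id.
Proof.
apply/positive_monoidP; split; last first.
  by exists (fun=> 0%N); split=> // x; exact: nearW.
by exists id; split=> // x; exact: cvg_id.
Qed.

Lemma positive_monoid_comp h1 h2 :
  positive_monoid g h1 -> positive_monoid g h2 -> positive_monoid g (h1 \o h2).
Proof.
move=> /positive_monoidP[hh1 [n1 [lc1 h1E]]] /positive_monoidP[hh2 [n2 [lc2 h2E]]].
apply/positive_monoidP; split; first exact: homeomorphism_comp.
exists (fun x => (n1 (h2 x) + n2 x)%N); split=> x; last first.
  by rewrite /= h1E {2}h2E iterD.
have : \forall y \near x, n1 (h2 y) = n1 (h2 x).
  exact: (homeomorphism_continuous hh2 (x := x)) (lc1 (h2 x)).
by apply: filterS2 (lc2 x) => y -> ->.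
Qed.

Lemma positive_monoid_induced A :
  clopen_star A -> positive_monoid g (induced g A).
Proof.
move=> cA; apply/positive_monoidP; split; first exact: induced_homeomorphism.
exists (induced_time g A); split; last exact: induced_iter.
exact: induced_time_locally_constant.
Qed.

(** One step of the descent on the bound of the exponents. By aperiodicity [S] is the support of
    [h]. *)
Lemma positive_monoid_divide h n N :
  homeomorphism h -> nat_locally_constant n ->
  (forall x, h x = iter (n x) g x) -> (forall x, n x <= N.+1)%N ->
  (forall x, h x = x) \/
  exists S h' n', [/\ clopen_star S, h = h' \o induced g S,
    homeomorphism h', nat_locally_constant n'
  & (forall x, h' x = iter (n' x) g x) /\ (forall x, n' x <= N)%N].
Proof.
move=> hh lc hE leN; pose S := [set x | (0 < n x)%N].
have cS : clopen S by exact: (nat_locally_constant_clopen (fun i => 0 < i)%N lc).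
have [Sne|S0] := pselect (S !=set0); last first.
  left=> x; rewrite hE; case nx: (n x) => //; case: S0.
  by exists x; rewrite /S /= nx.
right; have SS : clopen_star S by [].
have rS := minimal_recurrent SS.
(* A point [h x] outside [S] would be fixed by [h], so [h x = x] by injectivity, against
   aperiodicity. *)
have hS x : S x -> S (h x).
  move=> Sx; rewrite /S /= lt0n; apply/eqP => n0.
  have /(homeomorphism_inj hh) : h (h x) = h x by rewrite hE n0.
  by rewrite hE; exact: minimal_aperiodic.
(* For [x] in [S], [n x] is a time of return to [S], perhaps not the first. *)
have time_le x : (induced_time g S x <= n x)%N.
  rewrite /induced_time; case: ifPn => // /set_mem Sx.
  have [_ _ tmin] := return_timeP x rS; apply: (tmin (n x)) => //.
  by rewrite -hE; exact: hS.
have [k [fK fK' cf ck]] := induced_homeomorphism SS.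
(* By [time_le] the subtraction is never truncated. It lowers the exponent by at least one on [S];
   off [S] the exponent is already zero. *)
exists S, (h \o k), (fun x => n (k x) - induced_time g S (k x))%N; split=> //.
- by apply/funext => x /=; rewrite fK.
- by apply: homeomorphism_comp => //; exists (induced g S).
- move=> x; have lt := induced_time_locally_constant SS (k x).
  have : \forall y \near x, n (k y) = n (k x) := ck x _ (lc (k x)).
  have : \forall y \near x, induced_time g S (k y) = induced_time g S (k x).
    exact: ck x _ lt.
  by apply: filterS2 => y -> ->.
- split=> x.
    by rewrite /= hE -[in RHS](fK' x) fK induced_iter -iterD subnK.
  have [Sk|nSk] := pselect (S (k x)).
    have := induced_time_gt0 rS Sk; have := leN (k x); lia.
  have -> : n (k x) = 0%N by apply/eqP; rewrite -leqn0 leqNgt; apply/negP.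
  by [].
Qed.

End MinimalSystem.

(** * Normal forms of words and the presentation *)

Section Presentation.
Variables (X : topologicalType) (g : X -> X).
Hypothesis gmin : compact_minimal_system g.
Local Notation CO := (set_type (@clopen_star X)).
Local Notation gens := (set_type (induced_generators g)).
Local Notation congruent := (gen_congruence (@induced_relations X g)).
Implicit Types (a b c : CO) (s t : seq CO) (u v : seq gens) (U : set X) (x : X).

(** Every letter arises in this way, so words can be handled as lists of clopen sets. *)
Definition generator a : gens :=
  exist _ (induced g (val a) : selfmap X)
    (mem_set (ex_intro2 _ _ (val a) (set_valP a) erefl)).

Lemma generator_surj (e : gens) : exists a, generator a = e.
Proof.
case: (set_valP e) => A cA Ae; exists (exist _ A (mem_set cA)).
exact: val_inj.
Qed.

Lemma map_generator_surj u : exists s, map generator s = u.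
Proof.
elim: u => [|e u [s <-]]; first by exists [::].
by have [a <-] := generator_surj e; exists (a :: s).
Qed.

Lemma induced_relations_eval u v :
  induced_relations u v -> word_eval u = word_eval v.
Proof.
move=> [A [B [cA cB uE vE]]]; rewrite /word_eval.
rewrite -(big_map val xpredT id) -[RHS](big_map val xpredT id) uE vE.
by rewrite !big_cons !big_nil !mulg1; exact: induced_comp.
Qed.

Lemma word_eval_cat u v : word_eval (u ++ v) = (word_eval u * word_eval v)%g.
Proof. exact: big_cat. Qed.

Lemma congruence_eval u v : congruent u v -> word_eval u = word_eval v.
Proof.
elim=> {u v} [u v|//|u v _ -> //|u v w _ -> _ -> //|u v u' v' _ uv _ uv'].
  exact: induced_relations_eval.
by rewrite !word_eval_cat uv uv'.
Qed.

Definition ast_elt a b : CO := exist _ (clopen_ast g (val a) (val b))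
  (mem_set (clopen_star_ast gmin (set_valP a) (set_valP b))).

Definition cup_elt a b : CO := exist _ (val a `|` val b)
  (mem_set (clopen_star_setU (set_valP a) (set_valP b))).

Lemma congruence_swap a b :
  congruent (map generator [:: a; b]) (map generator [:: ast_elt a b; cup_elt a b]).
Proof.
apply: gen_congruence_base; exists (val a), (val b); split=> //.
- exact: set_valP.
- exact: set_valP.
Qed.

Lemma congruence_push s a : exists s' c,
  [/\ congruent (map generator (a :: s)) (map generator (rcons s' c)),
      size s' = size s, val a `<=` val c,
      {in s', forall b, val b `<=` val c}
    & forall U, {in a :: s, forall b, val b `<=` U} -> val c `<=` U].
Proof.
elim: s a => [|b s IH] a.
  exists [::], a; split=> //; first exact: gen_congruence_refl.
  by move=> U; apply; rewrite mem_head.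
have [s' [c [sE szE cupc s'c cU]]] := IH (cup_elt a b).
exists (ast_elt a b :: s'), c; split=> /=.
- apply: gen_congruence_trans.
    exact: (gen_congruence_cat (congruence_swap a b) (gen_congruence_refl _ _)).
  exact: (gen_congruence_cat (gen_congruence_refl _ [:: _]) sE).
- by rewrite szE.
- by move=> x ax; apply: cupc; left.
- move=> e; rewrite inE => /predU1P[->|/s'c //].
  by move=> x /clopen_ast_sub; exact: cupc.
- move=> U sU; apply: cU => e; rewrite inE => /predU1P[->|es].
    by move=> x [] xe; [apply: (sU a)|apply: (sU b)]; rewrite ?inE ?eqxx ?orbT.
  by apply: sU; rewrite !inE es !orbT.
Qed.

(** Increasing words, built at the right end because the last set is the one that the value
    reveals. *)
Inductive chain : seq CO -> Prop :=
| chain_nil : chain [::]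
| chain_rcons s c :
    {in s, forall b, val b `<=` val c} -> chain s -> chain (rcons s c).

(** After a push all letters lie in the last one, and the prefix is treated by induction. The clause
    on [U] keeps the rewritten prefix inside that last letter. *)
Lemma congruence_chain s : exists t,
  [/\ chain t, congruent (map generator s) (map generator t)
    & forall U, {in s, forall b, val b `<=` U} -> {in t, forall b, val b `<=` U}].
Proof.
(* Induction on the length, since the prefix [s'] consists of new letters. *)
elim: {s}(size s) {-2}s (erefl (size s)) => [|m IH] [|a s] //= sz.
  by exists [::]; split=> //; [exact: chain_nil|exact: gen_congruence_refl].
have [s' [c [sE szE _ s'c cU]]] := congruence_push s a.
have [|t [ch s't tU]] := IH s'; first by case: sz => <-.
exists (rcons t c); split.
- by apply: chain_rcons => //; exact: tU.
- apply: gen_congruence_trans sE _; rewrite !map_rcons -!cats1.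
  exact: gen_congruence_cat s't (gen_congruence_refl _ _).
- move=> U /cU cU' b; rewrite mem_rcons inE => /predU1P[->//|bt].
  by apply: subset_trans cU'; exact: tU bt.
Qed.

Definition chain_eval s : X -> X := word_eval (map generator s).

Lemma chain_eval_rcons s c :
  chain_eval (rcons s c) = chain_eval s \o induced g (val c).
Proof.
rewrite /chain_eval map_rcons -cats1 word_eval_cat.
by rewrite [X in (_ * X)%g]/word_eval big_seq1.
Qed.

Lemma chain_eval_positive s : positive_monoid g (chain_eval s).
Proof.
elim/last_ind: s => [|s c IH].
  rewrite /chain_eval /word_eval big_nil; exact: positive_monoid_id.
rewrite chain_eval_rcons; apply: positive_monoid_comp => //.
by apply: positive_monoid_induced => //; exact: set_valP.
Qed.

Lemma chain_eval_out s x : {in s, forall b, ~ val b x} -> chain_eval s x = x.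
Proof.
elim/last_ind: s => [_|s c IH sx]; first by rewrite /chain_eval /word_eval big_nil.
rewrite chain_eval_rcons /= induced_out; last first.
  by apply: sx; rewrite mem_rcons mem_head.
by apply: IH => b bs; apply: sx; rewrite mem_rcons inE bs orbT.
Qed.

(** On [c], the last letter advances a point by a positive time and the others never move it back,
    so aperiodicity applies. *)
Lemma chain_eval_supp s c : {in s, forall b, val b `<=` val c} ->
  [set x | chain_eval (rcons s c) x <> x] = val c.
Proof.
move=> sc; apply/seteqP; split=> x /=.
  apply: contra_notP => ncx; apply: chain_eval_out => b.
  rewrite mem_rcons inE => /predU1P[->//|/sc bc].
  by move=> /bc.
move=> cx; rewrite chain_eval_rcons /=.
have /positive_monoidP[_ [n [_ ->]]] := chain_eval_positive s.
rewrite induced_iter -iterD; apply: minimal_aperiodic => //.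
rewrite addn_gt0 induced_time_gt0 ?orbT //.
by apply: minimal_recurrent => //; exact: set_valP.
Qed.

(** The support gives the last letter, which is then cancelled on the right by surjectivity of its
    induced map. *)
Lemma chain_eval_inj s t :
  chain s -> chain t -> chain_eval s = chain_eval t -> s = t.
Proof.
have nil_rcons r c : {in r, forall b, val b `<=` val c} ->
    chain_eval [::] <> chain_eval (rcons r c).
  move=> rc e; case: (set_valP c) => _ [x cx].
  move: (cx); rewrite -(chain_eval_supp rc) -e; apply.
  by rewrite /chain_eval /word_eval big_nil.
move=> ch; elim: ch t => {s} [|s c sc _ IH] t.
  by case=> // r c rc _ /(nil_rcons _ _ rc).
case=> [|r d rd chr e]; first by move=> /esym /(nil_rcons _ _ sc).
have cd : c = d.
  by apply: val_inj; rewrite -(chain_eval_supp sc) -(chain_eval_supp rd) e.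
rewrite -{}cd in e *; congr rcons; apply: IH chr _.
move: e; rewrite !chain_eval_rcons => e; apply/funext => y.
have [x <-] := induced_surj gmin (set_valP c) y.
exact: (congr1 (@^~ x) e).
Qed.

(** Induction on a uniform bound of the exponents; each division splits off the rightmost letter. *)
Lemma chain_eval_surj h : positive_monoid g h -> exists s, chain_eval s = h.
Proof.
move=> /positive_monoidP[hh [n [lc hE]]].
have cX : compact [set: X] by case: gmin.
have [N] := nat_locally_constant_bounded cX lc.
elim: N h n hh lc hE => [|N IH] h n hh lc hE nN.
  exists [::]; rewrite /chain_eval /word_eval big_nil; apply/funext => x.
  by rewrite hE; move: (nN x); rewrite leqn0 => /eqP ->.
have [hid|[S [h' [n' [cS -> hh' lc' [h'E n'N]]]]]] :=
  positive_monoid_divide gmin hh lc hE nN.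
  by exists [::]; rewrite /chain_eval /word_eval big_nil; apply/funext => x.
have [s <-] := IH h' n' hh' lc' h'E n'N.
exists (rcons s (exist _ S (mem_set cS))); exact: chain_eval_rcons.
Qed.

(** Words of equal value are congruent to chains of equal value, hence to the same chain. *)
Lemma positive_monoid_presentation :
  has_monoid_presentation (positive_monoid g) (@induced_relations X g).
Proof.
split.
  apply/seteqP; split=> [_ [u _ <-]|h /chain_eval_surj[s <-]].
    have [s <-] := map_generator_surj u; exact: chain_eval_positive.
  by exists (map generator s).
move=> u v; split=> [|/congruence_eval //].
have [s <-] := map_generator_surj u; have [t <-] := map_generator_surj v.
have [s' [chs ss' _]] := congruence_chain s.
have [t' [cht tt' _]] := congruence_chain t.
rewrite (congruence_eval ss') (congruence_eval tt') => /(chain_eval_inj chs cht) e.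
rewrite -e in tt'.
exact: gen_congruence_trans ss' (gen_congruence_sym tt').
Qed.

End Presentation.

Theorem proposition6p3 (X : topologicalType) (g : X -> X)
    (gmin : compact_minimal_system g) :
  (forall A B : set X, clopen_star A -> clopen_star B ->
     [/\ clopen_star (clopen_ast g A B),
         clopen_ast g A B `<=` A `|` B
       & induced g A \o induced g B =
         induced g (clopen_ast g A B) \o induced g (A `|` B)]) /\
  has_monoid_presentation (positive_monoid g) (@induced_relations X g).
Proof.
split; last exact: positive_monoid_presentation.
move=> A B cA cB; split.
- exact: clopen_star_ast.
- exact: clopen_ast_sub.
- exact: induced_comp.
Qed.
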